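(* Let $u\colon\mathbb{N}\to\mathbb{R}$ be a bounded nonnegative function. Then a vector $\xi\in\mathsf{L}^2(Z)$ belongs to $\mathrm{Dom}\,N_u$ if and only if $$\sum_{\sigma\in\Gamma}\big(\#_u(\sigma)\big)^2|\langle Z_\sigma,\xi\rangle|^2<\infty,$$ where $\#_u(\sigma)=\sum_{k=0}^\infty\mathbf{1}_\sigma(k)u(k)$. In that case, one has $$N_u\xi=\sum_{\sigma\in\Gamma}\#_u(\sigma)\langle Z_\sigma,\xi\rangle Z_\sigma .$$
   Context: $\mathbb{N}$ is the set of nonnegative integers and $\Gamma$ the set of all finite subsets of $\mathbb{N}$; $\mathbf{1}_\sigma$ is the indicator function of $\sigma\in\Gamma$. $(\Omega,\mathscr{F},\mathbb{P})$ is a probability space and $Z=(Z_n)_{n\ge0}$ an independent sequence of random variables with $\mathbb{P}\{Z_n=\theta_n\}=p_n$, $\mathbb{P}\{Z_n=-1/\theta_n\}=q_n$, where $0<p_n<1$, $q_n=1-p_n$, $\theta_n=\sqrt{q_n/p_n}$, and $\mathscr{F}$ is the $\sigma$-field generated by $Z$. $\mathsf{L}^2(Z)=L^2(\Omega,\mathscr{F},\mathbb{P})$ (complex-valued), with inner product $\langle\xi,\eta\rangle=\mathbb{E}[\overline{\xi}\eta]$. Put $Z_\emptyset=1$ and $Z_\sigma=\prod_{i\in\sigma}Z_i$; $\{Z_\sigma\mid\sigma\in\Gamma\}$ is an orthonormal basis of $\mathsf{L}^2(Z)$ (the canonical ONB). For $k\in\mathbb{N}$, $\partial_k$ is the bounded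 operator on $\mathsf{L}^2(Z)$ with $\partial_kZ_\sigma=\mathbf{1}_\sigma(k)Z_{\sigma\setminus\{k\}}$, and its adjoint satisfies $\partial_k^*Z_\sigma=[1-\mathbf{1}_\sigma(k)]Z_{\sigma\cup\{k\}}$, for all $\sigma\in\Gamma$. For bounded nonnegative $u\colon\mathbb{N}\to\mathbb{R}$, the 1D-weighted number operator $N_u$ associated with $u$ is $N_u\xi=\sum_{k=0}^\infty u(k)\partial_k^*\partial_k\xi$, with domain $\mathrm{Dom}\,N_u$ the set of all $\xi\in\mathsf{L}^2(Z)$ for which this series converges in $\mathsf{L}^2(Z)$. *)

(* Defs.v *)
From HB Require Import structures.
From mathcomp Require Import all_boot all_order all_algebra finmap.
From mathcomp Require Import generic_quotient.
From mathcomp Require Import all_classical all_reals all_analysis.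
(* Needed for the measurable structure of [\bar R]. *)
From mathcomp Require Import measurable_realfun.
From mathcomp Require Import complex ring.
From mathcomp Require summability.

Set Implicit Arguments.
Unset Strict Implicit.
Unset Printing Implicit Defensive.

Import Order.TTheory GRing.Theory Num.Theory.
Import numFieldNormedType.Exports.
Import ComplexField.Normc.

Local Open Scope classical_set_scope.
Local Open Scope complex_scope.
Local Open Scope ring_scope.

Local Notation Re := complex.Re.
Local Notation Im := complex.Im.

Section complex_parts.
Context (R : realType).
Implicit Types z w : R[i].

Lemma ReD z w : Re (z + w) = Re z + Re w.
Proof. by case: z w => ? ? []. Qed.

Lemma ImD z w : Im (z + w) = Im z + Im w.
Proof. by case: z w => ? ? []. Qed.

Lemma ReM z w : Re (z * w) = Re z * Re w - Im z * Im w.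
Proof. by case: z w => ? ? []. Qed.

Lemma ImM z w : Im (z * w) = Re z * Im w + Im z * Re w.
Proof. by case: z w => ? ? []. Qed.

Lemma normcE z : normc z = Num.sqrt (Re z ^+ 2 + Im z ^+ 2).
Proof. by case: z. Qed.

End complex_parts.

Section CLfun.
Context d (T : measurableType d) (R : realType) (P : probability T R).

Definition cLfun2 : {pred T -> R[i]} :=
  [pred f | ((@Re R \o f) \in Lfun P 2%:E) && ((@Im R \o f) \in Lfun P 2%:E)].

Let p1 : (1 <= 2%:E :> \bar R)%E. Proof. by rewrite lee_fin ler1n. Qed.

Let L0 : (0 : T -> R) \in Lfun P 2%:E := (Lfun_submod_closed P p1).1.
Let LD := (Lfun_submod_closed P p1).2.

Lemma cLfun2_submod_closed : submod_closed cLfun2.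
Proof.
split; first by apply/andP; split; exact: L0.
move=> a f g /andP[rf mf] /andP[rg mg].
apply/andP; split.
- rewrite (_ : _ \o _ = Re a *: (@Re R \o f) +
      (- Im a *: (@Im R \o f) + (@Re R \o g))); first exact/LD/LD.
  by apply/funext => x; rewrite [LHS]ReD ReM -addrA -mulNr.
- rewrite (_ : _ \o _ = Re a *: (@Im R \o f) +
      (Im a *: (@Re R \o f) + (@Im R \o g))); first exact/LD/LD.
  by apply/funext => x; rewrite [LHS]ImD ImM -addrA.
Qed.

HB.instance Definition _ := GRing.isSubmodClosed.Build _ _ cLfun2
  cLfun2_submod_closed.

Record CLfun := CLfunSub {
  CLfun_fun :> T -> R[i];
  CLfunP : CLfun_fun \in cLfun2 }.

HB.instance Definition _ := [isSub of CLfun for CLfun_fun].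
HB.instance Definition _ := [Choice of CLfun by <:].
HB.instance Definition _ := [SubChoice_isSubLmodule of CLfun by <:].

Lemma CLfunD (f g : CLfun) x : (f + g) x = f x + g x. Proof. by []. Qed.

Lemma CLfunN (f : CLfun) x : (- f) x = - f x. Proof. by []. Qed.

Lemma CLfunZ a (f : CLfun) x : (a *: f) x = a * f x. Proof. by []. Qed.

Definition caeq_op (f g : CLfun) : bool := `[< {ae P, forall x, f x = g x} >].

Let caeq_refl : reflexive caeq_op.
Proof. by move=> f; apply/asboolP/nearW. Qed.

Let caeq_sym : symmetric caeq_op.
Proof.
by move=> f g; apply/asboolP/asboolP; apply: filterS => x ->.
Qed.

Let caeq_trans : transitive caeq_op.
Proof.
move=> f g h /asboolP gf /asboolP fh; apply/asboolP.
by apply: filterS2 gf fh => x ->.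
Qed.

Canonical caeq := EquivRel caeq_op caeq_refl caeq_sym caeq_trans.

Local Open Scope quotient_scope.

Definition cL2 : Type := {eq_quot caeq}.
HB.instance Definition _ := Choice.on cL2.
HB.instance Definition _ := EqQuotient.on cL2.

Lemma cL2W (Q : cL2 -> Prop) : (forall f, Q (\pi_cL2 f)) -> forall u, Q u.
Proof. by move=> Qpi u; rewrite -[u]reprK. Qed.

Lemma cL2_pieqP (f g : CLfun) :
  \pi_cL2 f = \pi_cL2 g <-> {ae P, forall x, f x = g x}.
Proof. by split=> [/eqmodP/asboolP//|h]; apply/eqmodP/asboolP. Qed.

Lemma cL2_reprK (f : CLfun) : {ae P, forall x, repr (\pi_cL2 f) x = f x}.
Proof. by apply/cL2_pieqP; rewrite reprK. Qed.

Definition cL2_add (u v : cL2) : cL2 := \pi_cL2 (repr u + repr v).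
Definition cL2_opp (u : cL2) : cL2 := \pi_cL2 (- repr u).
Definition cL2_scale (a : R[i]) (u : cL2) : cL2 := \pi_cL2 (a *: repr u).

Lemma cL2_piD f g : \pi_cL2 (f + g) = cL2_add (\pi f) (\pi g).
Proof.
apply/cL2_pieqP; apply: filterS2 (cL2_reprK f) (cL2_reprK g) => x.
by rewrite !CLfunD => -> ->.
Qed.

Lemma cL2_piN f : \pi_cL2 (- f) = cL2_opp (\pi f).
Proof.
by apply/cL2_pieqP; apply: filterS (cL2_reprK f) => x; rewrite !CLfunN => ->.
Qed.

Lemma cL2_piZ a f : \pi_cL2 (a *: f) = cL2_scale a (\pi f).
Proof.
by apply/cL2_pieqP; apply: filterS (cL2_reprK f) => x; rewrite !CLfunZ => ->.
Qed.

Let addA : associative cL2_add.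
Proof.
move=> u v w; move: u; apply: cL2W => f.
move: v; apply: cL2W => g; move: w; apply: cL2W => h.
by rewrite -(cL2_piD g h) -(cL2_piD f g) -!cL2_piD addrA.
Qed.

Let addC : commutative cL2_add.
Proof.
move=> u v; move: u; apply: cL2W => f; move: v; apply: cL2W => g.
by rewrite -!cL2_piD addrC.
Qed.

Let add0 : left_id (\pi_cL2 0) cL2_add.
Proof. by move=> u; move: u; apply: cL2W => f; rewrite -cL2_piD add0r. Qed.

Let addN : left_inverse (\pi_cL2 0) cL2_opp cL2_add.
Proof. by move=> u; move: u; apply: cL2W => f; rewrite -(cL2_piN f) -cL2_piD addNr. Qed.

HB.instance Definition _ := GRing.isZmodule.Build cL2 addA addC add0 addN.

Let scaleA a b v : cL2_scale a (cL2_scale b v) = cL2_scale (a * b) v.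
Proof. by move: v; apply: cL2W => f; rewrite -(cL2_piZ b f) -!cL2_piZ scalerA. Qed.

Let scale1 : left_id 1 cL2_scale.
Proof. by move=> u; move: u; apply: cL2W => f; rewrite -cL2_piZ scale1r. Qed.

Let scaleDr : right_distributive cL2_scale +%R.
Proof.
move=> a u v; move: u; apply: cL2W => f; move: v; apply: cL2W => g.
by rewrite -[LHS]/(cL2_scale a (cL2_add _ _)) -[RHS]/(cL2_add _ _)
  -(cL2_piD f g) -(cL2_piZ a f) -(cL2_piZ a g) -cL2_piZ -cL2_piD scalerDr.
Qed.

Let scaleDl v : {morph cL2_scale^~ v : a b / a + b}.
Proof.
move=> a b; move: v; apply: cL2W => f.
by rewrite -[RHS]/(cL2_add _ _) -(cL2_piZ a f) -(cL2_piZ b f) -cL2_piZ -cL2_piD scalerDl.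
Qed.

HB.instance Definition _ := GRing.Zmodule_isLmodule.Build R[i] cL2
  scaleA scale1 scaleDr scaleDl.

(* Linear in the second argument. *)
Definition cL2_ip (u v : cL2) : R[i] :=
  let h x := (repr u x)^* * repr v x in
  (\int[P]_x Re (h x)) +i* (\int[P]_x Im (h x)).

Definition cL2_norm (u : cL2) : R := Num.sqrt (Re (cL2_ip u u)).

Lemma CLfun_mul (f g : CLfun) :
  [/\ P.-integrable setT (EFin \o (fun x => Re (f x) * Re (g x))),
    P.-integrable setT (EFin \o (fun x => Re (f x) * Im (g x))),
    P.-integrable setT (EFin \o (fun x => Im (f x) * Re (g x)))
  & P.-integrable setT (EFin \o (fun x => Im (f x) * Im (g x)))].
Proof.
have /andP[rf mf] := CLfunP f; have /andP[rg mg] := CLfunP g.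
by split; apply/Lfun1_integrable; exact: Lfun2_mul_Lfun1.
Qed.

Lemma Re_cmulJ (z w : R[i]) : Re (z^* * w) = Re z * Re w + Im z * Im w.
Proof. by case: z w => a b [c e] /=; rewrite mulNr opprK. Qed.

Lemma Im_cmulJ (z w : R[i]) : Im (z^* * w) = Re z * Im w - Im z * Re w.
Proof. by case: z w => a b [c e] /=; rewrite mulNr. Qed.

Lemma integrable_cmulJ (f g : CLfun) :
  P.-integrable setT (EFin \o (fun x => Re ((f x)^* * g x))) /\
  P.-integrable setT (EFin \o (fun x => Im ((f x)^* * g x))).
Proof.
have [irr iri iir iii] := CLfun_mul f g; split.
- rewrite (_ : _ \o _ = (EFin \o (fun x => (Re (f x) * Re (g x))%R)) \+
    (EFin \o (fun x => (Im (f x) * Im (g x))%R)))%E; first exact: integrableD.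
  by apply/funext => x /=; rewrite Re_cmulJ EFinD.
- rewrite (_ : _ \o _ = (EFin \o (fun x => (Re (f x) * Im (g x))%R)) \-
    (EFin \o (fun x => (Im (f x) * Re (g x))%R)))%E; first exact: integrableB.
  by apply/funext => x /=; rewrite Im_cmulJ EFinB.
Qed.

Lemma ae_eq_Rintegral (f g : T -> R) :
  P.-integrable setT (EFin \o f) -> P.-integrable setT (EFin \o g) ->
  {ae P, forall x, f x = g x} -> \int[P]_x f x = \int[P]_x g x.
Proof.
move=> /integrableP[mf _] /integrableP[mg _] fg; congr fine.
by apply: ae_eq_integral => //; apply: filterS fg => x -> _.
Qed.

Lemma cL2_ipE (f g : CLfun) : cL2_ip (\pi_cL2 f) (\pi_cL2 g) =
  (\int[P]_x Re ((f x)^* * g x)) +i* (\int[P]_x Im ((f x)^* * g x)).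
Proof.
congr Complex; apply: ae_eq_Rintegral;
  try (by case: (integrable_cmulJ f g));
  try (by case: (integrable_cmulJ (repr (\pi_cL2 f)) (repr (\pi_cL2 g))));
  by apply: filterS2 (cL2_reprK f) (cL2_reprK g) => x -> ->.
Qed.

Lemma cL2_ipDr u v w : cL2_ip u (v + w) = cL2_ip u v + cL2_ip u w.
Proof.
move: u; apply: cL2W => f; move: v; apply: cL2W => g; move: w; apply: cL2W => h.
rewrite -[_ + _ in LHS]/(cL2_add _ _) -cL2_piD !cL2_ipE.
have [irg iig] := integrable_cmulJ f g; have [irh iih] := integrable_cmulJ f h.
apply/eqP; rewrite eq_complex /= -!RintegralD//; apply/andP; split; apply/eqP.
- by apply: eq_Rintegral => x _; rewrite -ReD -mulrDr.
- by apply: eq_Rintegral => x _; rewrite -ImD -mulrDr.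
Qed.

Lemma cL2_ipZr a u v : cL2_ip u (a *: v) = a * cL2_ip u v.
Proof.
move: u; apply: cL2W => f; move: v; apply: cL2W => g.
rewrite -[_ *: _ in LHS]/(cL2_scale _ _) -cL2_piZ !cL2_ipE.
have [ir ii] := integrable_cmulJ f g.
have iZ b h : P.-integrable setT (EFin \o h) ->
    P.-integrable setT (EFin \o (fun x => b * h x)).
  by move=> ih; rewrite (_ : _ \o _ = (fun x => b%:E * (h x)%:E)%E)//;
    exact: integrableZl.
apply/eqP; rewrite eq_complex ReM ImM /=; apply/andP; split; apply/eqP.
- rewrite -!RintegralZl// -RintegralB//; do ?exact: iZ.
  by apply: eq_Rintegral => x _; rewrite -[LHS]/(Re ((f x)^* * (a * g x))) mulrCA ReM.
- rewrite -!RintegralZl// -RintegralD//; do ?exact: iZ.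
  by apply: eq_Rintegral => x _; rewrite -[LHS]/(Im ((f x)^* * (a * g x))) mulrCA ImM.
Qed.

Lemma cL2_ipC u v : cL2_ip u v = (cL2_ip v u)^*.
Proof.
move: u; apply: cL2W => f; move: v; apply: cL2W => g; rewrite !cL2_ipE.
have [ir ii] := integrable_cmulJ g f.
congr Complex; first by apply: eq_Rintegral => x _; rewrite !Re_cmulJ;
  rewrite [X in X + _]mulrC [X in _ + X]mulrC.
rewrite -mulN1r -RintegralZl//; apply: eq_Rintegral => x _.
by rewrite mulN1r !Im_cmulJ opprB [X in X - _]mulrC [X in _ - X]mulrC.
Qed.

Lemma cL2_ip_ge0 u : 0 <= Re (cL2_ip u u).
Proof.
by apply: Rintegral_ge0 => x _; rewrite Re_cmulJ addr_ge0// -expr2 sqr_ge0.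
Qed.

Lemma cL2_norm_eq0 u : cL2_norm u = 0 -> u = 0.
Proof.
move: u; apply: cL2W => f /eqP; rewrite sqrtr_eq0 => ip0.
have {ip0} : Re (cL2_ip (\pi_cL2 f) (\pi_cL2 f)) = 0.
  by apply/eqP; rewrite eq_le ip0 cL2_ip_ge0.
have [ir _] := integrable_cmulJ f f.
rewrite cL2_ipE /= => ip0; apply/cL2_pieqP.
have ge0 x : 0 <= Re ((f x)^* * f x).
  by rewrite Re_cmulJ addr_ge0// -expr2 sqr_ge0.
have int0 : (\int[P]_x `|(Re ((f x)^* * f x))%:E| = 0)%E.
  under eq_integral do rewrite gee0_abs ?lee_fin//.
  by rewrite -[LHS]fineK ?[fine _]ip0//; exact: integrable_fin_num.
have mf := measurable_int _ ir.
have := (ae_eq_integral_abs P measurableT mf).1 int0.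
apply: filterS => x /(_ I) [] /eqP; rewrite Re_cmulJ -!expr2.
rewrite paddr_eq0 ?sqr_ge0// !sqrf_eq0 => /andP[/eqP r0 /eqP i0].
by apply/eqP; rewrite eq_complex r0 i0 !eqxx.
Qed.

Lemma cL2_ipDl u v w : cL2_ip (u + v) w = cL2_ip u w + cL2_ip v w.
Proof. by rewrite cL2_ipC cL2_ipDr rmorphD/= -!cL2_ipC. Qed.

Lemma cL2_ipZl a u v : cL2_ip (a *: u) v = a^* * cL2_ip u v.
Proof. by rewrite cL2_ipC cL2_ipZr rmorphM/= -cL2_ipC. Qed.

Lemma cL2_normZ a u : cL2_norm (a *: u) = normc a * cL2_norm u.
Proof.
rewrite /cL2_norm cL2_ipZl cL2_ipZr mulrA ReM Re_cmulJ Im_cmulJ.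
rewrite [Re a * Im a]mulrC subrr mul0r subr0 -!expr2.
by rewrite sqrtrM ?addr_ge0 ?sqr_ge0//; case: a.
Qed.

Lemma cL2_sqr_norm u : cL2_norm u ^+ 2 = Re (cL2_ip u u).
Proof. by rewrite sqr_sqrtr// cL2_ip_ge0. Qed.

Lemma cL2_sqr_normD u v : cL2_norm (u + v) ^+ 2 =
  cL2_norm u ^+ 2 + Re (cL2_ip u v) *+ 2 + cL2_norm v ^+ 2.
Proof.
rewrite !cL2_sqr_norm cL2_ipDl !cL2_ipDr !ReD [cL2_ip v u]cL2_ipC.
have -> : Re (cL2_ip u v)^* = Re (cL2_ip u v) by case: (cL2_ip u v).
by rewrite mulr2n !addrA.
Qed.

Lemma cL2_Re_ip_le u v : Re (cL2_ip u v) <= cL2_norm u * cL2_norm v.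
Proof.
have u0 : 0 <= cL2_norm u by exact: sqrtr_ge0.
have v0 : 0 <= cL2_norm v by exact: sqrtr_ge0.
have [vE|vN] := eqVneq (cL2_norm v) 0.
  have -> : v = 0 *: v by rewrite (cL2_norm_eq0 vE) scaler0.
  by rewrite cL2_ipZr mul0r mulr_ge0// sqrtr_ge0.
set r := Re (cL2_ip u v); set a := cL2_norm u; set b := cL2_norm v.
have bgt : 0 < b by rewrite lt_neqAle eq_sym vN.
have := sqr_ge0 (cL2_norm (u + (- (r / b ^+ 2))%:C *: v)).
rewrite cL2_sqr_normD cL2_normZ cL2_ipZr ReM /= mul0r subr0 expr0n addr0.
rewrite sqrtr_sqr normrN exprMn real_normK ?num_real// -/a -/b -/r.
have -> : a ^+ 2 + (- (r / b ^+ 2) * r) *+ 2 + (r / b ^+ 2) ^+ 2 * b ^+ 2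
  = a ^+ 2 - r ^+ 2 / b ^+ 2 by field.
rewrite subr_ge0 ler_pdivrMr ?exprn_gt0// -exprMn => rab.
by rewrite (le_trans (ler_norm r))// -(ler_pXn2r (n := 2)) ?nnegrE ?mulr_ge0//
  real_normK ?num_real.
Qed.

Lemma cL2_normD u v : cL2_norm (u + v) <= cL2_norm u + cL2_norm v.
Proof.
rewrite -(ler_pXn2r (n := 2)) ?nnegrE ?addr_ge0 ?sqrtr_ge0//.
rewrite cL2_sqr_normD sqrrD lerD2r lerD2l lerMn2r/=; exact: cL2_Re_ip_le.
Qed.

Let ler_normD u v :
  (cL2_norm (u + v))%:C <= (cL2_norm u)%:C + (cL2_norm v)%:C :> R[i].
Proof. by rewrite -rmorphD lecR cL2_normD. Qed.

Let normrZ a u : (cL2_norm (a *: u))%:C = `|a| * (cL2_norm u)%:C :> R[i].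
Proof. by rewrite cL2_normZ normc_def -normcE rmorphM. Qed.

Let normr0_eq0 u : (cL2_norm u)%:C = 0 :> R[i] -> u = 0.
Proof. by move=> [/cL2_norm_eq0]. Qed.

HB.instance Definition _ := Lmodule_isNormed.Build R[i] cL2
  ler_normD normrZ normr0_eq0.

Lemma cL2_normE u : `|u| = (cL2_norm u)%:C :> R[i]. Proof. by []. Qed.

End CLfun.

Section bernoulli_noise.
Context d (T : measurableType d) (R : realType) (P : probability T R).
Implicit Types (Z : nat -> {RV P >-> R}) (p u : nat -> R).

Definition mutually_independent Z :=
  forall (J : {fset nat}) (B : nat -> set R), (forall i, measurable (B i)) ->
    P (\bigcap_(i in [set` J]) Z i @^-1` B i) =
    (\prod_(i <- J) P (Z i @^-1` B i))%E.

Definition theta p n : R := Num.sqrt ((1 - p n) / p n).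

Record bernoulli_noise p Z : Prop := BernoulliNoise {
  noise_proba : forall n, 0 < p n < 1 ;
  noise_pos : forall n, P [set x | Z n x = theta p n] = (p n)%:E ;
  noise_neg : forall n, P [set x | Z n x = - (theta p n)^-1] = (1 - p n)%:E ;
  noise_indep : mutually_independent Z ;
  noise_generates : @measurable d T =
    <<s \bigcup_n preimage_set_system setT (Z n) measurable >> }.

(* The class of [f], or the junk value 0 when [f] is not square integrable. *)
Definition cL2_class (f : T -> R[i]) : cL2 P := (\pi_(cL2 P) (insubd 0 f))%qT.

Definition noise_prod Z (s : {fset nat}) (x : T) : R := \prod_(i <- s) Z i x.

(* By [noise_prod_cLfun2] below, this is never the junk value of [cL2_class]
   for a Bernoulli noise. *)
Definition canonical_vec Z (s : {fset nat}) : cL2 P :=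
  cL2_class (fun x => (noise_prod Z s x)%:C).

Lemma measurable_noise_prod Z s : measurable_fun setT (noise_prod Z s).
Proof. by apply: measurable_prod => i _; exact: measurable_funPT. Qed.

Lemma noise_ae p Z n : bernoulli_noise p Z ->
  {ae P, forall x, Z n x = theta p n \/ Z n x = - (theta p n)^-1}.
Proof.
move=> [p01 pos neg _ _]; have /andP[p0 p1] := p01 n.
have mA r : measurable [set x | Z n x = r].
  have := measurable_funPT (Z n) measurableT _ (measurable_set1 r).
  by rewrite setTI.
have th : theta p n != - (theta p n)^-1.
  have t0 : 0 < theta p n by rewrite sqrtr_gt0 divr_gt0// subr_gt0.
  by rewrite gt_eqF// (lt_trans _ t0)// oppr_lt0 invr_gt0.
pose A := [set x | Z n x = theta p n] `|` [set x | Z n x = - (theta p n)^-1].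
have PA : P A = 1%E.
  have dis : [set x | Z n x = theta p n] `&`
      [set x | Z n x = - (theta p n)^-1] = set0.
    by apply/seteqP; split=> // x [/= -> /eqP]; rewrite (negbTE th).
  apply: etrans (measureU P (mA _) (mA _) dis) _.
  by apply: etrans (congr2 _ (pos n) (neg n)) _; rewrite -EFinD addrC subrK.
exists (~` A); split.
- by apply: measurableC; exact: measurableU.
- by rewrite probability_setC ?PA ?subee//; exact: measurableU.
- by apply: subsetC => x.
Qed.

Lemma noise_prod_bounded p Z s : bernoulli_noise p Z ->
  exists c, {ae P, forall x, `|noise_prod Z s x| <= c}.
Proof.
move=> bZ; pose m i := Num.max `|theta p i| `|(theta p i)^-1|.
exists (\prod_(i <- s) m i); rewrite /noise_prod.
elim: (enum_fset s) => [|i l IH].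
  by apply: nearW => x; rewrite !big_nil normr1.
apply: filterS2 (noise_ae i bZ) IH => x Zi Zl.
rewrite !big_cons normrM ler_pM// /m le_max.
by case: Zi => ->; rewrite ?normrN lexx ?orbT.
Qed.

Lemma ae_bounded_Lfun2 (f : T -> R) (c : R) : measurable_fun setT f ->
  {ae P, forall x, `|f x| <= c} -> f \in Lfun P 2%:E.
Proof.
move=> mf fc; apply/andP; split; rewrite inE//= /finite_norm unlock.
apply: poweR_lty.
have mc : measurable_fun [set: T] (fun x => (`|f x| `^ 2)%:E).
  apply/measurable_EFinP.
  apply: (@measurableT_comp _ _ _ _ _ _ (fun x : R => x `^ 2)) => //.
  exact: measurableT_comp.
apply: (@le_lt_trans _ _ (\int[P]_x (cst (`|c| `^ 2)%:E x))%E); last first.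
  by apply/integrable_lty => //; exact: finite_measure_integrable_cst.
apply: ae_ge0_le_integral => //.
- by move=> x _; exact: poweR_ge0.
- by move=> x _; rewrite lee_fin powR_ge0.
apply: filterS fc => x fxc _ /=.
rewrite lee_fin; apply: ge0_ler_powR; rewrite ?nnegrE//.
by rewrite (le_trans fxc) ?ler_norm.
Qed.

Lemma noise_prod_cLfun2 p Z s : bernoulli_noise p Z ->
  (fun x => (noise_prod Z s x)%:C) \in cLfun2 P.
Proof.
move=> bZ; have [c Zc] := noise_prod_bounded s bZ; apply/andP; split.
  exact: ae_bounded_Lfun2 (measurable_noise_prod Z s) Zc.
apply: (@ae_bounded_Lfun2 _ 0); first exact: measurable_cst.
by apply: nearW => x /=; rewrite normr0.
Qed.

Definition bounded_operator (A : cL2 P -> cL2 P) :=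
  exists M : R, forall xi, cL2_norm (A xi) <= M * cL2_norm xi.

(* [B] is the adjoint of [A]. *)
Definition is_adjoint (A B : cL2 P -> cL2 P) :=
  forall xi eta, cL2_ip (B xi) eta = cL2_ip xi (A eta).

(* As the canonical vectors of a Bernoulli noise form an orthonormal basis,
   these conditions determine [A]. *)
Definition annihilation Z (k : nat) (A : cL2 P -> cL2 P) :=
  bounded_operator A /\
  forall s : {fset nat}, A (canonical_vec Z s) =
    if k \in s then canonical_vec Z (s `\ k)%fset else 0.

Section number_operator.
Variables (D Dstar : nat -> cL2 P -> cL2 P) (u : nat -> R).

Definition number_series (xi : cL2 P) : (cL2 P)^nat :=
  series (fun k => (u k)%:C *: Dstar k (D k xi)).

Definition number_dom : set (cL2 P) := [set xi | cvgn (number_series xi)].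

Definition number_op (xi : cL2 P) : cL2 P := limn (number_series xi).

End number_operator.

Definition weighted_count (u : nat -> R) (s : {fset nat}) : R :=
  \big[+%R/0]_(0 <= k <oo) ((k \in s)%:R * u k).

End bernoulli_noise.

(* Main.v *)
Require Import Defs.
From mathcomp Require Import all_boot all_order all_algebra finmap.
From mathcomp Require Import all_classical all_reals all_analysis measurable_realfun.
From mathcomp Require Import complex.
From mathcomp Require summability.
From mathcomp Require Import generic_quotient ring lra.
Import Order.TTheory GRing.Theory Num.Theory.
Import numFieldNormedType.Exports.
Import ComplexField.Normc.
Local Open Scope classical_set_scope.
Local Open Scope complex_scope.
Local Open Scope ring_scope.

(* The canonical vectors are orthonormal by independence. They are total because
   a function of the two-valued variable [Z_i] is affine in [Z_i], so that a
   vector orthogonal to every [Z_s] integrates to zero over the cylinder sets of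
   the noise, a pi-system generating the sigma-field. With the completeness of
   [L^2] this makes every vector the sum of its Fourier series.
   The adjoint relation gives
   [<Z_s, D*_k D_k xi> = 1_s(k) <Z_s, xi>], so the [n]-th partial sum [S_n] of
   the series of [N_u xi] has coefficients [#_{u,n}(s) <Z_s, xi>], where
   [#_{u,n}(s)] counts only the [k < n] and equals [#_u(s)] for large [n].
   If [S_n] converges, its limit has coefficients [#_u(s) <Z_s, xi>], which are
   square summable by Bessel. Conversely Riesz-Fischer provides a vector [eta]
   with these coefficients, of partial sums [eta_A]; for [n] large depending on
   [A], the coefficients of [eta - S_n] are dominated by those of
   [eta - eta_A], whence [|eta - S_n| <= |eta - eta_A|]. *)

#[local] Existing Instance summability.totally_filter.

(** * Almost everywhere convergence and lower limits *)

(** The absolute increments have an integrable sum [S]. It is finite almost everywhere, and there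
    the telescoping series converges absolutely. *)
Lemma fast_cauchy_ae (R : realType) (d : measure_display) (T : measurableType d)
    (P : probability T R) (f : nat -> T -> R) :
  (forall n, measurable_fun setT (f n)) ->
  (forall n, (\int[P]_x ((f n.+1 x - f n x) ^+ 2)%:E <= (2 ^- n ^+ 2)%:E)%E) ->
  exists2 g : T -> R, measurable_fun setT g &
    {ae P, forall x, f n x @[n --> \oo] --> g x}.
Proof.
move=> mf hf.
have mD n : measurable_fun setT (fun x => f n.+1 x - f n x).
  exact: measurable_funB.
have mabs n : measurable_fun setT (fun x => (`|f n.+1 x - f n x|)%:E).
  by apply/measurable_EFinP; exact: measurableT_comp (mD n).
(* AM-GM: [|t| <= 2 ^ n t^2 + 2 ^- n]. *)
have int1 n : (\int[P]_x (`|f n.+1 x - f n x|)%:E <= (4 / 2 ^+ n.+1)%:E)%E.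
  have p0 : 0 < 2 ^+ n :> R by rewrite exprn_gt0.
  have mS : measurable_fun setT (fun x => ((f n.+1 x - f n x) ^+ 2)%:E).
    by apply/measurable_EFinP; exact: measurable_funX.
  apply: (@le_trans _ _ (\int[P]_x ((2 ^+ n)%:E * ((f n.+1 x - f n x) ^+ 2)%:E
      + cst (2 ^- n)%:E x))%E).
    apply: ge0_le_integral => //.
    - by apply: emeasurable_funD => //; exact: measurable_funeM.
    - move=> x _; rewrite /cst -EFinM -EFinD lee_fin.
      set t := _ - _; rewrite -[X in _ * X](real_normK (num_real t)).
      have [m q] : exists m : R, m * 2 ^+ n = 1 /\ 2 ^- n = m.
        by exists (2 ^- n); rewrite mulVf// gt_eqF.
      case: q => mE ->; have := sqr_ge0 (2 ^+ n * `|t| - 1 / 2); move: mE p0.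
      move: (2 ^+ n) (`|t|) => a b mE p0 sq.
      (* Multiplied by [a], which stands for [2 ^+ n], the difference of the two sides is a square
         plus 3/4, because [m * a = 1]. *)
      rewrite -subr_ge0 -(pmulr_rge0 _ p0).
      have -> : a * (a * b ^+ 2 + m - b) = (a * b - 1 / 2) ^+ 2 + 3 / 4
        + (m * a - 1) by field.
      rewrite mE subrr; lra.
  rewrite ge0_integralD//; first last.
  - by move=> x _; rewrite lee_fin invr_ge0 ltW.
  - exact: measurable_funeM.
  - by move=> x _; rewrite -EFinM lee_fin mulr_ge0 ?sqr_ge0// ltW.
  rewrite ge0_integralZl//; first last.
  - by move=> x _; rewrite lee_fin sqr_ge0.
  have -> : (\int[P]_x cst (2 ^- n)%:E x = (2 ^- n)%:E)%E.
    rewrite integral_cst//; apply: etrans (congr1 _ (probability_setT P)) _.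
    by rewrite mule1.
  apply: (@le_trans _ _ ((2 ^+ n)%:E * (2 ^- n ^+ 2)%:E + (2 ^- n)%:E)%E).
    by rewrite leeD2r// lee_pmul2l// lte_fin.
  rewrite -EFinM -EFinD lee_fin [2 ^+ n.+1]exprS.
  by rewrite le_eqVlt; apply/orP; left; apply/eqP; field; rewrite gt_eqF.
pose S x := (\sum_(0 <= n <oo) (`|f n.+1 x - f n x|)%:E)%E.
have mS : measurable_fun setT S.
  by apply: ge0_emeasurable_sum => // n x _ _; rewrite lee_fin.
have S0 x : (0 <= S x)%E by apply: nneseries_ge0 => n _ _; rewrite lee_fin.
have Sint : P.-integrable setT S.
  apply/integrableP; split => //.
  under eq_integral do rewrite gee0_abs//.
  rewrite integral_nneseries//.
  (* The bound in [int1] has the form [4 / 2 ^+ n.+1] so that [epsilon_trick0] sums it to 4. *)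
  apply: (@le_lt_trans _ _ (\sum_(0 <= n <oo) (4 / 2 ^+ n.+1)%:E)%E).
    by apply: lee_nneseries => // n _ _; exact: integral_ge0.
  apply: (@le_lt_trans _ _ (4%:E)%E); last exact: ltry.
  rewrite [leLHS](_ : _ = (\sum_(0 <= n <oo) (4 / (2 ^ n.+1)%:R)%:E)%E).
    exact: epsilon_trick0.
  by apply: eq_eseriesr => n _; rewrite natrX.
(* The upper limit exists at every point, which makes [g] measurable on the whole space; it is the
   true limit wherever [f n x] converges. *)
pose g x := fine (limn_esup (fun n => (f n x)%:E)).
exists g.
  apply: (@measurableT_comp _ _ _ _ _ _ fine); first exact: fine_measurable.
  by apply: measurable_fun_limn_esup => n; apply/measurable_EFinP.
apply: filterS (integrable_ae measurableT Sint) => x /(_ I) Sfin.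
have cvgf : cvgn (f^~ x).
  have : cvgn (series (telescope (f^~ x))).
    apply: normed_cvg; apply: nondecreasing_is_cvgn.
      move=> i j ij; apply: (@nondecreasing_series _ _ xpredT 0%N) ij => k _ _.
      exact: normr_ge0.
    exists (fine (S x)) => _ [n _ <-].
    rewrite -lee_fin fineK// /series /= -sumEFin.
    exact: nneseries_lim_ge.
  rewrite telescopeK => c.
  rewrite (_ : f^~ x = (fun n => f n x - f 0%N x + f 0%N x)); last first.
    by apply/funext => n; rewrite subrK.
  by apply: is_cvgD c _; exact: is_cvg_cst.
rewrite /g; have -> : limn_esup (fun n => (f n x)%:E) = (limn (f^~ x))%:E.
  apply: (cvg_limn_einf_sup _).2; apply: cvg_EFin cvgf.
  by apply: nearW.
exact: cvgf.
Qed.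

Lemma measurable_fun_limn_einf (R : realType) (d : measure_display)
    (T : measurableType d) (D : set T) (f : nat -> T -> \bar R) :
  (forall n, measurable_fun D (f n)) ->
  measurable_fun D (fun x => limn_einf (f^~ x)).
Proof.
move=> mf; rewrite (_ : (fun _ => _) =
    -%E \o (fun x => limn_esup ((fun n y => - f n y)%E^~ x))).
  apply: measurableT_comp => //; apply: measurable_fun_limn_esup => n.
  exact: measurableT_comp.
apply/funext => x /=; rewrite -limn_einfN; congr limn_einf.
by apply/funext => n /=; rewrite oppeK.
Qed.

(** Each tail infimum is at most the term of index [maxn i n], to which the bound applies. *)
Lemma limn_einf_le (R : realType) (u : nat -> \bar R) (i : nat) (c : \bar R) :
  (forall n, (i <= n)%N -> (u n <= c)%E) -> (limn_einf u <= c)%E.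
Proof.
move=> uc; rewrite limn_einf_lim; apply: lime_le; first exact: is_cvg_einfs.
apply: nearW => n; apply: le_trans (uc (maxn i n) (leq_maxl _ _)).
by apply: ereal_inf_lbound; exists (maxn i n) => //=; exact: leq_maxr.
Qed.

Lemma sqr_integral_Lfun2 (R : realType) (d : measure_display)
    (T : measurableType d) (P : probability T R) (f : T -> R) :
  measurable_fun setT f -> (\int[P]_x ((f x) ^+ 2)%:E < +oo)%E ->
  f \in Lfun P 2%:E.
Proof.
move=> mf fi; apply/andP; split; rewrite inE//= /finite_norm unlock.
apply: poweR_lty; apply: le_lt_trans fi.
rewrite le_eqVlt; apply/orP; left; apply/eqP; apply: eq_integral => x _ /=.
by rewrite -[2%R]/(2%:R) powR_mulrn// real_normK ?num_real.
Qed.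

(** * Completeness of the complex [L^2] *)

Section cL2_complete.
Context {R : realType} {d : measure_display} {T : measurableType d}.
Context {P : probability T R}.
Local Open Scope quotient_scope.

Local Notation Re := complex.Re.
Local Notation Im := complex.Im.

Lemma normc2E (z : R[i]) : normc z ^+ 2 = Re z ^+ 2 + Im z ^+ 2.
Proof. by rewrite Defs.normcE sqr_sqrtr// addr_ge0 ?sqr_ge0. Qed.

Lemma measurable_cLfun2 (f : CLfun P) :
  measurable_fun setT (@Re R \o f) /\ measurable_fun setT (@Im R \o f).
Proof.
have /andP[rf mf] := CLfunP f.
by split; [move: rf => /andP[]|move: mf => /andP[]]; rewrite inE.
Qed.

Lemma cL2_norm_integral (f : CLfun P) :
  ((cL2_norm (\pi_(cL2 P) f)) ^+ 2)%:E = (\int[P]_x (normc (f x) ^+ 2)%:E)%E.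
Proof.
have [ir _] := integrable_cmulJ f f.
rewrite cL2_sqr_norm cL2_ipE /= /Rintegral fineK; last first.
  exact: integrable_fin_num.
by apply: eq_integral => x _; rewrite Re_cmulJ normc2E -!expr2.
Qed.

Lemma cL2_addE (f g : CLfun P) :
  \pi_(cL2 P) f + \pi_(cL2 P) g = \pi_(cL2 P) (f + g).
Proof. by rewrite cL2_piD. Qed.

Lemma cL2_subE (f g : CLfun P) :
  \pi_(cL2 P) f - \pi_(cL2 P) g = \pi_(cL2 P) (f - g).
Proof. by rewrite cL2_piD cL2_piN. Qed.

(** The real and imaginary parts of the representatives [f n] converge almost everywhere, to the
    parts of a function [g]. Fatou's lemma, applied to the squares of [f n - f i] as [n] grows, then
    bounds the distance from [g] to [f i]. *)
Lemma cL2_fast_cauchy (v : nat -> cL2 P) :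
  (forall i j, (i <= j)%N -> cL2_norm (v j - v i) <= 2 ^- i) ->
  exists w, forall i, cL2_norm (w - v i) <= 2 ^- i.
Proof.
move=> hv; pose f n := repr (v n).
have fi i j : (i <= j)%N ->
    (\int[P]_x (normc (f j x - f i x) ^+ 2)%:E <= (2 ^- i ^+ 2)%:E)%E.
  move=> /hv; rewrite -[v j]reprK -[v i]reprK cL2_subE.
  move=> vij; rewrite -(cL2_norm_integral (f j - f i)) lee_fin.
  by rewrite lerXn2r// nnegrE ?sqrtr_ge0// invr_ge0 exprn_ge0.
have mf n := (measurable_cLfun2 (f n)).
have mn (g h : T -> R[i]) : measurable_fun setT (@Re R \o g) ->
    measurable_fun setT (@Im R \o g) -> measurable_fun setT (@Re R \o h) ->
    measurable_fun setT (@Im R \o h) ->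
    measurable_fun setT (fun x => (normc (g x - h x) ^+ 2)%:E).
  move=> rg ig rh ih; apply/measurable_EFinP.
  rewrite (_ : (fun _ => _) = (fun x => ((@Re R \o g) x - (@Re R \o h) x) ^+ 2
      + ((@Im R \o g) x - (@Im R \o h) x) ^+ 2)).
    by apply: measurable_funD; apply: measurable_funX; exact: measurable_funB.
  by apply/funext => x /=; rewrite normc2E; case: (g x) (h x) => ? ? [].
have [gr mgr fgr] : exists2 g : T -> R, measurable_fun setT g &
    {ae P, forall x, Re (f n x) @[n --> \oo] --> g x}.
  apply: fast_cauchy_ae => n; first exact: (mf n).1.
  apply: le_trans (fi n n.+1 (leqnSn n)).
  apply: ge0_le_integral => //.
  - by move=> x _; rewrite lee_fin sqr_ge0.
  - apply/measurable_EFinP; apply: measurable_funX; apply: measurable_funB.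
      exact: (mf n.+1).1.
    exact: (mf n).1.
  - by apply: mn; [exact: (mf _).1|exact: (mf _).2|exact: (mf _).1|
      exact: (mf _).2].
  - move=> x _; rewrite lee_fin normc2E.
    by case: (f n x) (f n.+1 x) => ? ? [? ?] /=; rewrite lerDl sqr_ge0.
have [gi mgi fgi] : exists2 g : T -> R, measurable_fun setT g &
    {ae P, forall x, Im (f n x) @[n --> \oo] --> g x}.
  apply: fast_cauchy_ae => n; first exact: (mf n).2.
  apply: le_trans (fi n n.+1 (leqnSn n)).
  apply: ge0_le_integral => //.
  - by move=> x _; rewrite lee_fin sqr_ge0.
  - apply/measurable_EFinP; apply: measurable_funX; apply: measurable_funB.
      exact: (mf n.+1).2.
    exact: (mf n).2.
  - by apply: mn; [exact: (mf _).1|exact: (mf _).2|exact: (mf _).1|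
      exact: (mf _).2].
  - move=> x _; rewrite lee_fin normc2E.
    by case: (f n x) (f n.+1 x) => ? ? [? ?] /=; rewrite lerDr sqr_ge0.
pose g x := gr x +i* gi x.
have mfn n i : measurable_fun setT (fun x => (normc (f n x - f i x) ^+ 2)%:E).
  by apply: mn; [exact: (mf _).1|exact: (mf _).2|exact: (mf _).1|
    exact: (mf _).2].
have mg i : measurable_fun setT (fun x => (normc (g x - f i x) ^+ 2)%:E).
  by apply: mn => //; [exact: (mf _).1|exact: (mf _).2].
have gi2 i : (\int[P]_x (normc (g x - f i x) ^+ 2)%:E <= (2 ^- i ^+ 2)%:E)%E.
  apply: (@le_trans _ _
    (\int[P]_x limn_einf (fun n => (normc (f n x - f i x) ^+ 2)%:E))%E).
    apply: ae_ge0_le_integral => //.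
    - by move=> x _; rewrite lee_fin sqr_ge0.
    - move=> x _; rewrite limn_einf_lim; apply: lime_ge.
        exact: is_cvg_einfs.
      apply: nearW => n; apply: le_ereal_inf_tmp => _ [m _ <-].
      by rewrite lee_fin sqr_ge0.
    - exact: measurable_fun_limn_einf.
    (* Where both parts converge, the lower limit is a limit and the inequality is an equality. *)
    apply: filterS2 fgr fgi => x rx ix _; rewrite le_eqVlt.
    apply/orP; left; apply/eqP/esym.
    apply: (cvg_limn_einf_sup _).1; apply: cvg_EFin; first exact: nearW.
    rewrite (_ : _ \o _ = (fun n => (Re (f n x) - Re (f i x)) ^+ 2
      + (Im (f n x) - Im (f i x)) ^+ 2)); last first.
      apply/funext => n /=; rewrite normc2E.
      by case: (f n x) (f i x) => ? ? [].
    rewrite (_ : normc _ ^+ 2 = (gr x - Re (f i x)) ^+ 2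
      + (gi x - Im (f i x)) ^+ 2); last first.
      by rewrite normc2E /g; case: (f i x).
    by apply: cvgD; rewrite !expr2; apply: cvgM; apply: cvgB => //;
      exact: cvg_cst.
  apply: le_trans (fatou P measurableT _ _) _ => //.
    by move=> n x _; rewrite lee_fin sqr_ge0.
  by apply: (@limn_einf_le _ _ i) => n /fi.
have hL i : (fun x => g x - f i x) \in cLfun2 P.
  have mr : measurable_fun setT (fun x => Re (g x - f i x)).
    rewrite (_ : (fun x => Re _) = (fun x => gr x - (@Re R \o f i) x)).
      by apply: measurable_funB => //; exact: (mf i).1.
    by apply/funext => x /=; case: (f i x).
  have mi : measurable_fun setT (fun x => Im (g x - f i x)).
    rewrite (_ : (fun x => Im _) = (fun x => gi x - (@Im R \o f i) x)).
      by apply: measurable_funB => //; exact: (mf i).2.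
    by apply/funext => x /=; case: (f i x).
  apply/andP; split; apply: sqr_integral_Lfun2 => //;
    apply: le_lt_trans (le_lt_trans (gi2 i) (ltry _)); apply: ge0_le_integral => //.
  - by move=> x _; rewrite lee_fin sqr_ge0.
  - by apply/measurable_EFinP; exact: measurable_funX.
  - by move=> x _; rewrite lee_fin normc2E lerDl sqr_ge0.
  - by move=> x _; rewrite lee_fin sqr_ge0.
  - by apply/measurable_EFinP; exact: measurable_funX.
  - by move=> x _; rewrite lee_fin normc2E lerDr sqr_ge0.
(* The differences [g - f i] are known to be square integrable, not [g] itself, so the limit is
   built as the class of [g - f 0] plus [v 0]. *)
pose h i : CLfun P := CLfunSub (hL i).
exists (\pi_(cL2 P) (h 0%N) + v 0%N) => i.
have -> : \pi_(cL2 P) (h 0%N) + v 0%N - v i = \pi_(cL2 P) (h i).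
  rewrite -[v 0%N]reprK -[v i]reprK -addrA cL2_subE cL2_addE.
  congr (\pi_(cL2 P) _).
  by apply/val_inj/funext => x; rewrite /= !fctE addrA subrK.
rewrite -(@ler_pXn2r _ 2) ?nnegrE ?sqrtr_ge0 ?invr_ge0 ?exprn_ge0//.
by rewrite -lee_fin cL2_norm_integral; exact: gi2.
Qed.

End cL2_complete.

(** * Orthonormal families and Fourier expansions along finite index sets *)

Section orthonormal.
Context {R : realType} {d : measure_display} {T : measurableType d}.
Context {P : probability T R}.
Local Notation Re := complex.Re.
Implicit Types (v w : cL2 P).

(** The norm of [cL2 P] as a normed module takes values in [R[i]]. A positive element of [R[i]] is
    real, so real radii suffice. *)
Lemma cL2_cvgP (J : Type) (F : set_system J) (f : J -> cL2 P) w : Filter F ->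
  f @ F --> w <->
  forall eps : R, 0 < eps -> \forall x \near F, cL2_norm (w - f x) <= eps.
Proof.
move=> FF; split=> [/cvgrPdist_le fw eps e0|fw].
  have e0' : 0 < eps%:C :> R[i] by rewrite ltcR.
  by apply: filterS (fw _ e0') => x; rewrite cL2_normE lecR.
apply/cvgrPdist_le => -[a b]; rewrite ltcE /= => /andP[/eqP -> a0].
by apply: filterS (fw a a0) => x; rewrite cL2_normE lecR.
Qed.

Lemma normc_nneg (z : R[i]) : 0 <= normc z.
Proof. by rewrite Defs.normcE sqrtr_ge0. Qed.

Lemma cL2_norm_ge0 v : 0 <= cL2_norm v.
Proof. exact: sqrtr_ge0. Qed.

Lemma cL2_normN v : cL2_norm (- v) = cL2_norm v.
Proof. by rewrite -scaleN1r cL2_normZ normcN normc1 mul1r. Qed.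

Lemma cL2_distC v w : cL2_norm (v - w) = cL2_norm (w - v).
Proof. by rewrite -opprB cL2_normN. Qed.

Lemma cL2_ip0r v : cL2_ip v 0 = 0.
Proof. by rewrite -(scale0r 0) cL2_ipZr mul0r. Qed.

Lemma cL2_ip0l v : cL2_ip 0 v = 0.
Proof. by rewrite cL2_ipC cL2_ip0r rmorph0. Qed.

Lemma cL2_ipBr u v w : cL2_ip u (v - w) = cL2_ip u v - cL2_ip u w.
Proof. by rewrite cL2_ipDr -scaleN1r cL2_ipZr mulN1r. Qed.

Lemma cL2_ip_sumr (J : Type) (s : seq J) (f : J -> cL2 P) v :
  cL2_ip v (\sum_(j <- s) f j) = \sum_(j <- s) cL2_ip v (f j).
Proof.
elim: s => [|j s IH]; first by rewrite !big_nil cL2_ip0r.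
by rewrite !big_cons cL2_ipDr IH.
Qed.

Lemma big_fset_sub {I : choiceType} (V : nmodType) (F : I -> V)
    {A B : {fset I}} : (A `<=` B)%fset ->
  \sum_(i <- B) F i = \sum_(i <- A) F i + \sum_(i <- (B `\` A)%fset) F i.
Proof.
move=> /fsetIidPr AB; rewrite (big_fsetID _ (mem A))/=; congr (_ + _).
  by apply: eq_fbigl => i; rewrite !inE/= -[in RHS]AB inE.
by apply: eq_fbigl => i; rewrite !inE/= andbC.
Qed.

Context {I : choiceType} (e : I -> cL2 P).
Hypothesis e_on : forall i j, cL2_ip (e i) (e j) = (i == j)%:R.

Definition lincomb (c : I -> R[i]) (A : {fset I}) : cL2 P :=
  \sum_(i <- A) c i *: e i.

Lemma ip_lincomb c A i : cL2_ip (e i) (lincomb c A) = (i \in A)%:R * c i.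
Proof.
rewrite cL2_ip_sumr; under eq_bigr do rewrite cL2_ipZr e_on.
have [iA|iA] := boolP (i \in A).
  rewrite (big_fsetD1 i)//= eqxx mulr1 mul1r big_seq big1 ?addr0// => j.
  by rewrite in_fsetD1 => /andP[ji _]; rewrite eq_sym (negbTE ji) mulr0.
rewrite mul0r big_seq big1// => j jA.
by case: eqVneq iA => [->|]; rewrite ?jA ?mulr0.
Qed.

Lemma ip_lincombl c A v :
  cL2_ip (lincomb c A) v = \sum_(i <- A) (c i)^* * cL2_ip (e i) v.
Proof.
rewrite cL2_ipC cL2_ip_sumr rmorph_sum; apply: eq_bigr => i _.
by rewrite cL2_ipZr rmorphM/= -cL2_ipC.
Qed.

Lemma Re_normc2 (z : R[i]) : Re (z^* * z) = normc z ^+ 2.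
Proof. by rewrite normc2E; case: z => a b /=; ring. Qed.

Lemma Re_sum (J : Type) (s : seq J) (f : J -> R[i]) :
  Re (\sum_(j <- s) f j) = \sum_(j <- s) Re (f j).
Proof.
elim: s => [|j s IH]; first by rewrite !big_nil.
by rewrite !big_cons ReD IH.
Qed.

Lemma sqr_norm_lincomb c A :
  cL2_norm (lincomb c A) ^+ 2 = \sum_(i <- A) normc (c i) ^+ 2.
Proof.
rewrite cL2_sqr_norm ip_lincombl Re_sum !big_seq; apply: eq_bigr => i iA.
by rewrite ip_lincomb iA mul1r Re_normc2.
Qed.

(** The error is orthogonal to [e i] for every [i] in [A], hence to the projection. *)
Lemma lincomb_pythagoras (A : {fset I}) v : cL2_norm v ^+ 2 =
  cL2_norm (lincomb (fun i => cL2_ip (e i) v) A) ^+ 2 +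
  cL2_norm (v - lincomb (fun i => cL2_ip (e i) v) A) ^+ 2.
Proof.
set p := lincomb _ A.
have ip0 : cL2_ip p (v - p) = 0.
  rewrite ip_lincombl big_seq big1// => i iA.
  by rewrite cL2_ipBr ip_lincomb iA mul1r subrr mulr0.
by have := cL2_sqr_normD p (v - p); rewrite ip0 subrKC /= mul0rn addr0.
Qed.

Lemma bessel v (A : {fset I}) :
  \sum_(i <- A) normc (cL2_ip (e i) v) ^+ 2 <= cL2_norm v ^+ 2.
Proof.
rewrite (lincomb_pythagoras A) sqr_norm_lincomb lerDl.
by rewrite sqr_ge0.
Qed.

Lemma normc_ip_le i v : normc (cL2_ip (e i) v) <= cL2_norm v.
Proof.
have := bessel v [fset i]%fset; rewrite big_seq_fset1.
by rewrite ler_pXn2r ?nnegrE ?cL2_norm_ge0 ?normc_nneg.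
Qed.

Lemma sqr_norm_lincomb_sub c (A B : {fset I}) : (A `<=` B)%fset ->
  cL2_norm (lincomb c B - lincomb c A) ^+ 2 =
  \sum_(i <- B) normc (c i) ^+ 2 - \sum_(i <- A) normc (c i) ^+ 2.
Proof.
move=> AB; have -> : lincomb c B - lincomb c A = lincomb c (B `\` A)%fset.
  by rewrite /lincomb (big_fset_sub _ _ AB)/= addrAC subrr add0r.
rewrite (big_fset_sub _ (fun i => normc (c i) ^+ 2) AB)/=.
by rewrite addrAC subrr add0r sqr_norm_lincomb.
Qed.

(** Once the sum of squares over [A] is close to the supremum over all finite sets, enlarging [A]
    hardly moves the partial sum. This yields a fast Cauchy sequence, whose limit is also the limit
    along all finite sets. *)
Lemma riesz_fischer {c} {M : R} :
  (forall A : {fset I}, \sum_(i <- A) normc (c i) ^+ 2 <= M) ->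
  exists w, lincomb c A @[A --> summability.totally] --> w.
Proof.
move=> cM; pose Q (A : {fset I}) := \sum_(i <- A) normc (c i) ^+ 2.
have supQ : has_sup (range Q).
  by split; [exists (Q fset0), fset0|exists M => _ [A _ <-]; exact: cM].
(* The set [A] comes within [(2 ^- n.+1) ^+ 2] of the supremum. *)
have tail n : exists A : {fset I}, forall B, (A `<=` B)%fset ->
    cL2_norm (lincomb c B - lincomb c A) <= 2 ^- n.+1.
  have e0 : 0 < (2 ^- n.+1) ^+ 2 :> R by rewrite exprn_gt0// invr_gt0 exprn_gt0.
  have [_ [A _ <-] QA] := sup_adherent e0 supQ; exists A => B AB.
  rewrite -(@ler_pXn2r _ 2) ?nnegrE ?cL2_norm_ge0 ?invr_ge0 ?exprn_ge0//.
  rewrite sqr_norm_lincomb_sub// lerBlDl -lerBlDr.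
  apply: le_trans (ltW QA); rewrite lerD2r.
  by apply: (ub_le_sup supQ.2); exists B.
have [A hA] := choice tail.
have half n : 2 ^- n.+1 + 2 ^- n.+1 = 2 ^- n :> R.
  by rewrite exprS invfM -mulrDl; field; rewrite expf_neq0.
(* Passing through the union of [A i] and [A j] costs at most [2 ^- i.+1] twice, hence the exponent
   [n.+1] in [tail]. *)
have [w hw] : exists w, forall i, cL2_norm (w - lincomb c (A i)) <= 2 ^- i.
  apply: cL2_fast_cauchy => i j ij.
  rewrite -(subrKA (lincomb c (A i `|` A j)%fset)) -half.
  apply: le_trans (cL2_normD _ _) _; apply: lerD.
    rewrite cL2_distC; apply: le_trans (hA _ _ (fsubsetUr _ _)) _.
    by rewrite lef_pV2 ?posrE ?exprn_gt0// ler_weXn2l ?ler1n.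
  exact/hA/fsubsetUl.
exists w; apply/cL2_cvgP => eps e0.
have [n n_eps] : exists n, 2 ^- n + 2 ^- n.+1 <= eps.
  have [n hn] : exists n, 2 ^- n < eps / 2.
    have [n _ hn] := near_infty_natSinv_expn_lt (PosNum (divr_gt0 e0 (ltr0Sn _ 1))).
    by exists n; have := hn n (leqnn n); rewrite /= div1r.
  exists n; rewrite (splitr eps) lerD// (le_trans _ (ltW hn))//.
  by rewrite lef_pV2 ?posrE ?exprn_gt0// ler_weXn2l ?ler1n.
exists (A n) => //= B AB.
rewrite -(subrKA (lincomb c (A n))) (le_trans _ n_eps)//.
apply: le_trans (cL2_normD _ _) _; apply: lerD; first exact: hw.
by rewrite cL2_distC hA.
Qed.

(** The coefficients of [w] and [f x] differ by at most the norm of [w - f x], by Bessel for a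
    single index. *)
Lemma ip_limit {J : Type} {F : set_system J} {FF : ProperFilter F}
    {f : J -> cL2 P} {w i a} :
  f @ F --> w ->
  (\forall x \near F, cL2_ip (e i) (f x) = a) -> cL2_ip (e i) w = a.
Proof.
move=> /cL2_cvgP fw fa; apply/eqP; rewrite -subr_eq0; apply/eqP/eq0_normc.
apply/eqP; rewrite eq_le normc_nneg andbT; apply/ler_addgt0Pl => eps e0.
have [x [fxw <-]] := filter_ex (filterI (fw _ e0) fa).
by rewrite -cL2_ipBr addr0 (le_trans (normc_ip_le _ _)).
Qed.

Hypothesis e_total : forall v, (forall i, cL2_ip (e i) v = 0) -> v = 0.

(** Bessel and Riesz-Fischer give some limit [w]. Its coefficients are those of [v], and totality
    forces [w = v]. *)
Lemma fourier_expansion v :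
  lincomb (fun i => cL2_ip (e i) v) A @[A --> summability.totally] --> v.
Proof.
have [w hw] := riesz_fischer (bessel v).
suff wv : w = v by rewrite -[X in _ --> X]wv.
apply/eqP; rewrite -subr_eq0; apply/eqP/e_total => i.
apply/eqP; rewrite cL2_ipBr subr_eq0; apply/eqP.
apply: (ip_limit hw); exists [fset i]%fset => //= A.
by rewrite /= fsub1set ip_lincomb => ->; rewrite mul1r.
Qed.

(** A partial sum of [v] lies within [eps] of [v], and its norm is at most that of [w] by Bessel for
    [w]. *)
Lemma cL2_norm_le v w :
  (forall i, normc (cL2_ip (e i) v) <= normc (cL2_ip (e i) w)) ->
  cL2_norm v <= cL2_norm w.
Proof.
move=> vw; apply/ler_addgt0Pl => eps e0.
have /cL2_cvgP /(_ _ e0) /filter_ex [A vA] := fourier_expansion v.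
rewrite -(subrK (lincomb (fun i => cL2_ip (e i) v) A) v).
apply: le_trans (cL2_normD _ _) _; apply: lerD => //.
rewrite -(@ler_pXn2r _ 2) ?nnegrE ?cL2_norm_ge0// (le_trans _ (bessel w A))//.
rewrite sqr_norm_lincomb; apply: ler_sum => i _.
by rewrite lerXn2r// nnegrE normc_nneg.
Qed.

End orthonormal.

(** * Almost everywhere bounded functions and integrals of affine products *)

Section ae_bounded.
Context {R : realType} {d : measure_display} {T : measurableType d}.

(** The bound holds almost everywhere only, since the noise takes its two values almost everywhere
    only. *)
Definition ae_bounded (P : probability T R) (g : T -> R) : Prop :=
  measurable_fun setT g /\ exists c, {ae P, forall x, `|g x| <= c}.

Context {P : probability T R}.
Lemma ae_boundedM {f g : T -> R} : ae_bounded P f -> ae_bounded P g ->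
  ae_bounded P (fun x => f x * g x).
Proof.
move=> [mf [c fc]] [mg [c' gc']]; split; first exact: measurable_funM.
by exists (c * c'); apply: filterS2 fc gc' => x xc xc'; rewrite normrM ler_pM.
Qed.

Lemma ae_bounded_prod {s : seq nat} {X : nat -> T -> R} :
  (forall i, ae_bounded P (X i)) -> ae_bounded P (fun x => \prod_(i <- s) X i x).
Proof.
move=> bX; elim: s => [|i s IH].
  under eq_fun do rewrite big_nil.
  split; first exact: measurable_cst.
  by exists 1; apply: nearW => x; rewrite normr1.
by under eq_fun do rewrite big_cons; exact: ae_boundedM.
Qed.

Lemma ae_bounded_affine {a b : R} {X : T -> R} :
  ae_bounded P X -> ae_bounded P (fun x => a + b * X x).
Proof.
move=> [mX [c Xc]]; split.
  by apply: measurable_funD => //; exact: measurable_funM.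
exists (`|a| + `|b| * c); apply: filterS Xc => x Xx.
by rewrite (le_trans (ler_normD _ _))// lerD2l normrM ler_wpM2l.
Qed.

Lemma integrable_mul_ae_bounded {f g : T -> R} :
  P.-integrable setT (EFin \o f) -> ae_bounded P g ->
  P.-integrable setT (EFin \o (fun x => f x * g x)).
Proof.
move=> /[dup] fi /integrableP[/measurable_EFinP mf _] [mg [c gc]].
have mfg : measurable_fun setT (fun x => f x * g x) by exact: measurable_funM.
apply/integrableP; split; first exact/measurable_EFinP.
apply: (@le_lt_trans _ _ (\int[P]_x (`|c|%:E * `|(f x)%:E|))%E).
  apply: ae_ge0_le_integral => //.
  - by apply/measurable_EFinP; exact: measurableT_comp mfg.
  - apply: measurable_funeM; apply: measurableT_comp => //.
    exact/measurable_EFinP.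
  apply: filterS gc => x gx _ /=.
  rewrite -EFinM lee_fin normrM mulrC ler_wpM2r//.
  exact: le_trans gx (ler_norm c).
rewrite ge0_integralZl//; last first.
  by apply: measurableT_comp => //; exact/measurable_EFinP.
by rewrite lte_mul_pinfty//; case/integrableP : fi.
Qed.

(** Multilinearity: expanding the factor at [j] gives [a j] times the case of [J] plus [b j] times
    the case of [J] enlarged by [j], so [J] accumulates the factors already chosen. Orthonormality
    uses this with [k = 1] and indicators of independent events, totality with [k = 0] and the noise
    itself. *)
Lemma affine_prod_integral {f : T -> R} {X : nat -> T -> R} {m : nat -> R}
    {k : R} (a b : nat -> R) {l : seq nat} {J : {fset nat}} :
  P.-integrable setT (EFin \o f) ->
  (forall i, ae_bounded P (X i)) ->
  (forall J : {fset nat},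
    \int[P]_x (f x * \prod_(i <- J) X i x) = k * \prod_(i <- J) m i) ->
  uniq l -> {in l, forall i, i \notin J} ->
  \int[P]_x (f x * (\prod_(i <- J) X i x
    * \prod_(i <- l) (a i + b i * X i x))) =
  k * (\prod_(i <- J) m i * \prod_(i <- l) (a i + b i * m i)).
Proof.
move=> fi bX hX; elim: l J => [J _ _|j l IH J /= /andP[jl ul] lJ].
  rewrite big_nil mulr1 -hX; apply: eq_Rintegral => x _.
  by rewrite big_nil mulr1.
have jJ : j \notin J by apply: lJ; rewrite mem_head.
have lJ' : {in l, forall i, i \notin J}.
  by move=> i il; apply: lJ; rewrite in_cons il orbT.
have ljJ : {in l, forall i, i \notin (j |` J)%fset}.
  move=> i il; rewrite in_fset1U negb_or lJ' // andbT.
  by apply: contraNneq jl => <-.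
pose g (J' : {fset nat}) x := f x * (\prod_(i <- J') X i x
    * \prod_(i <- l) (a i + b i * X i x)).
have gi J' : P.-integrable setT (EFin \o g J').
  apply: integrable_mul_ae_bounded => //; apply: ae_boundedM.
    exact: ae_bounded_prod.
  by apply: ae_bounded_prod => i; exact: ae_bounded_affine.
have giZ c J' : P.-integrable setT (EFin \o (fun x => c * g J' x)).
  rewrite (_ : _ \o _ = (fun x => c%:E * (EFin \o g J') x)%E)//.
  exact: integrableZl.
transitivity (\int[P]_x (a j * g J x + b j * g (j |` J)%fset x)).
  apply: eq_Rintegral => x _; rewrite /g big_cons big_fsetU1//=; ring.
rewrite RintegralD// !RintegralZl// !IH//.
rewrite big_cons big_fsetU1//=; ring.
Qed.

End ae_bounded.

Lemma prod_indic {R : realType} {T : Type} (J : {fset nat}) (S : nat -> set T) x :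
  \prod_(i <- J) \1_(S i) x = \1_(\bigcap_(i in [set` J]) S i) x :> R.
Proof.
rewrite indicE; have [xS|xS] := boolP (x \in \bigcap_(i in [set` J]) S i).
  rewrite big_seq big1// => i iJ; rewrite indicE mem_set//.
  by move: xS; rewrite inE => /(_ i); apply.
move: xS; rewrite notin_setE => /existsNP[i /not_implyP[iJ xi]].
by rewrite (big_fsetD1 i)//= indicE memNset// mul0r.
Qed.

(** * Orthonormality and totality of the canonical vectors of a Bernoulli noise *)

Section noise.
Context {R : realType} {d : measure_display} {T : measurableType d}.
Context {P : probability T R} {p : nat -> R} {Z : nat -> {RV P >-> R}}.
Hypothesis bZ : bernoulli_noise p Z.
Local Notation Re := complex.Re.
Local Notation Im := complex.Im.

Lemma theta_gt0 n : 0 < theta p n.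
Proof.
have /andP[p0 p1] := noise_proba bZ n.
by rewrite sqrtr_gt0 divr_gt0// subr_gt0.
Qed.

Lemma sqr_theta n : theta p n ^+ 2 * p n = 1 - p n.
Proof.
have /andP[p0 p1] := noise_proba bZ n.
rewrite sqr_sqrtr ?mulfVK ?gt_eqF//.
by rewrite divr_ge0// ?subr_ge0 ltW.
Qed.

Lemma noise_ae_all : {ae P, forall x n,
  Z n x = theta p n \/ Z n x = - (theta p n)^-1}.
Proof. by apply/ae_foralln => n; exact: noise_ae bZ. Qed.

Lemma ae_bounded_noise n : ae_bounded P (Z n).
Proof.
split; first exact: measurable_funPT.
have [c] := noise_prod_bounded [fset n]%fset bZ; rewrite /noise_prod => Zc.
by exists c; apply: filterS Zc => x; rewrite big_seq_fset1.
Qed.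

Definition noise_event n := Z n @^-1` [set theta p n].

Lemma measurable_noise_preimage n (B : set R) :
  measurable B -> measurable (Z n @^-1` B).
Proof.
by move=> mB; have := measurable_funPT (Z n) measurableT _ mB; rewrite setTI.
Qed.

Lemma ae_bounded_noise_event n : ae_bounded P (\1_(noise_event n)).
Proof.
split; first exact/measurable_indic/measurable_noise_preimage.
by exists 1; apply: nearW => x; rewrite indicE normr_nat; case: (_ \in _).
Qed.

Lemma prod_noise_event_integral (J : {fset nat}) :
  \int[P]_x (1 * \prod_(i <- J) \1_(noise_event i) x) =
  1 * \prod_(i <- J) p i.
Proof.
under eq_Rintegral do rewrite mul1r prod_indic.
rewrite mul1r /Rintegral integral_indic//; last first.
  by apply: fin_bigcap_measurable => // i _; exact: measurable_noise_preimage.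
rewrite setIT -[RHS]/(fine (\prod_(i <- J) p i)%:E); congr fine.
apply: etrans (noise_indep bZ J (fun i => measurable_set1 (theta p i))) _.
by rewrite -prodEFin; apply: eq_bigr => i _; exact: (noise_pos bZ i).
Qed.

Lemma noise_prod_widen (s J : {fset nat}) x : (s `<=` J)%fset ->
  noise_prod Z s x = \prod_(i <- J) (if i \in s then Z i x else 1).
Proof.
move=> sJ; rewrite -(big_fset_incl _ sJ); last by move=> i _ /negbTE ->.
by rewrite /noise_prod !big_seq; apply: eq_bigr => i ->.
Qed.

(** Almost everywhere, [Z i] and its square are affine in the indicator of [noise_event i]. By
    independence the integral is the product of the means of the factors over the union of [s] and
    [t]. *)
Lemma noise_prod_orthonormal (s t : {fset nat}) :
  \int[P]_x (noise_prod Z s x * noise_prod Z t x) = (s == t)%:R.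
Proof.
(* The factor at [i] is the square of [Z i] if [i] lies in both sets, and [Z i] if it lies in one.
   Its value off [noise_event i] is [a i], and its value on it is [a i + b i]. *)
pose a i := if (i \in s) && (i \in t) then theta p i ^- 2 else - (theta p i)^-1.
pose b i := if (i \in s) && (i \in t) then theta p i ^+ 2 - theta p i ^- 2
            else theta p i + (theta p i)^-1.
have int1 : P.-integrable setT (EFin \o (cst 1 : T -> R)).
  exact: finite_measure_integrable_cst.
transitivity (\int[P]_x (1 * (noise_prod Z s x * noise_prod Z t x))).
  by apply: eq_Rintegral => x _; rewrite mul1r.
transitivity (\int[P]_x (1 * (\prod_(i <- fset0) \1_(noise_event i) x *
    \prod_(i <- (s `|` t)%fset) (a i + b i * \1_(noise_event i) x)))).
  apply: ae_eq_Rintegral.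
  - apply: integrable_mul_ae_bounded int1 _.
    by apply: ae_boundedM; apply: ae_bounded_prod ae_bounded_noise.
  - apply: integrable_mul_ae_bounded int1 _; apply: ae_boundedM.
      exact: ae_bounded_prod ae_bounded_noise_event.
    by apply: ae_bounded_prod => i; exact/ae_bounded_affine/ae_bounded_noise_event.
  apply: filterS noise_ae_all => x Zx.
  rewrite !mul1r big_seq_fset0 mul1r (noise_prod_widen _ _ _ (fsubsetUl s t)).
  rewrite (noise_prod_widen _ _ _ (fsubsetUr s t)) -big_split/= !big_seq.
  apply: eq_bigr => i; rewrite in_fsetU => ist; rewrite /a /b indicE.
  have t0 := theta_gt0 i.
  have xE : (x \in noise_event i) = (Z i x == theta p i).
    by apply/idP/eqP; rewrite inE.
  rewrite xE; have [->|->] := Zx i.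
    rewrite eqxx; move: ist; case: (i \in s); case: (i \in t) => //= _;
    rewrite ?mulr1 ?mul1r; ring.
  rewrite lt_eqF; last by rewrite (lt_trans _ t0)// oppr_lt0 invr_gt0.
  move: ist; case: (i \in s); case: (i \in t) => //= _;
  rewrite ?mulr1 ?mul1r ?mulr0 ?addr0 -?exprVn//; ring.
rewrite (affine_prod_integral a b int1 ae_bounded_noise_event
  prod_noise_event_integral (fset_uniq _))//.
rewrite big_seq_fset0 !mul1r.
(* The square of [Z i] has mean 1 and [Z i] has mean 0; both follow from [sqr_theta]. *)
have abE i : i \in (s `|` t)%fset -> a i + b i * p i = ((i \in s) && (i \in t))%:R.
  move=> _; have t0 := theta_gt0 i; have := sqr_theta i; rewrite /a /b.
  have tn : theta p i != 0 by rewrite gt_eqF.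
  move: (theta p i) tn => r rn rp; case: (_ && _).
    have -> : r ^- 2 + (r ^+ 2 - r ^- 2) * p i =
      p i + r ^+ 2 * p i + r ^- 2 * (1 - p i - r ^+ 2 * p i) by field.
    by rewrite rp subrr mulr0 addr0 subrKC.
  have -> : - r^-1 + (r + r^-1) * p i = r^-1 * (r ^+ 2 * p i - (1 - p i)) by field.
  by rewrite rp subrr mulr0.
rewrite big_seq; under eq_bigr do rewrite abE//; rewrite -big_seq.
have [<-|st] := eqVneq s t.
  rewrite big_seq big1// => i; rewrite in_fsetU => /orP[] -> //.
(* An index in exactly one of the two sets contributes a zero factor. *)
have [i ist] : exists i, (i \in s) != (i \in t).
  apply: contrapT => h; move/eqP: st; apply; apply/fsetP => i.
  by apply/eqP; apply: contraT => ist; exfalso; apply: h; exists i.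
rewrite (big_fsetD1 i)/=; last first.
  by rewrite in_fsetU; case: (_ \in s) ist; case: (_ \in t).
by case: (_ \in s) ist; case: (_ \in t) => //= _; rewrite mul0r.
Qed.

(** The family [B] runs over all indices and is trivial off [J], so that two cylinders intersect
    coordinate by coordinate. *)
Definition cylinder : set (set T) := [set S | exists (J : {fset nat}) B,
  [/\ forall i, measurable (B i), forall i, i \notin J -> B i = setT
    & S = \bigcap_i Z i @^-1` B i]].

Lemma cylinder_setI : setI_closed cylinder.
Proof.
move=> _ _ [J [B [mB JB ->]]] [J' [B' [mB' JB' ->]]].
exists (J `|` J')%fset, (fun i => B i `&` B' i); split.
- by move=> i; exact: measurableI.
- by move=> i; rewrite in_fsetU negb_or => /andP[iJ iJ']; rewrite JB// JB'// setIT.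
- apply/seteqP; split=> [x [xB xB'] i _|x xBB'].
    by split; [exact: xB|exact: xB'].
  by split=> i _; have [] := xBB' i I.
Qed.

Lemma measurable_cylinder : @measurable d T = <<s cylinder>>.
Proof.
rewrite (noise_generates bZ); apply/seteqP; split.
  apply: smallest_sub; first exact: smallest_sigma_algebra.
  move=> _ [n _ [B mB <-]]; apply: sub_sigma_algebra.
  exists [fset n]%fset, (fun i => if i == n then B else setT); split.
  - by move=> i; case: eqP.
  - by move=> i; rewrite in_fset1 => /negbTE ->.
  - rewrite setTI; apply/seteqP; split=> [x xB i _|x /(_ n I)].
      by rewrite /preimage/=; case: eqP => // ->.
    by rewrite /preimage/= eqxx.
apply: smallest_sub.
  rewrite -(noise_generates bZ); exact: sigma_algebra_measurable.
move=> _ [J [B [mB _ ->]]]; rewrite -(noise_generates bZ).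
apply: bigcap_measurable => // i _; exact: measurable_noise_preimage.
Qed.

(* Any function of a two-valued variable is affine. *)
Lemma indic_noise_affine (B : set R) n : exists ab : R * R, forall x,
  Z n x = theta p n \/ Z n x = - (theta p n)^-1 ->
  \1_B (Z n x) = ab.1 + ab.2 * Z n x.
Proof.
have t0 := theta_gt0 n; have tn : theta p n != 0 by rewrite gt_eqF.
pose b : R := (\1_B (theta p n) - \1_B (- (theta p n)^-1)) /
  (theta p n + (theta p n)^-1).
exists (\1_B (theta p n) - b * theta p n, b) => x /= [->|->].
  by rewrite subrK.
rewrite /b; move: (\1_B _) (\1_B _) => y z; field; rewrite tn /=.
by rewrite gt_eqF// addr_gt0// mulr_gt0.
Qed.

(** The indicator of a cylinder is almost everywhere a product of affine functions of finitely many
    [Z i], so [f] integrates to zero over it. Dynkin's theorem extends this to every measurable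
    set. *)
Lemma noise_prod_separates (f : T -> R) :
  P.-integrable setT (EFin \o f) ->
  (forall s : {fset nat}, \int[P]_x (f x * noise_prod Z s x) = 0) ->
  {ae P, forall x, f x = 0}.
Proof.
move=> fi f0; have cyl0 S : cylinder S -> (\int[P]_(x in S) (f x)%:E = 0)%E.
  move=> [J [B [mB JB SE]]].
  have [ab abE] := choice (fun n => indic_noise_affine (B n) n).
  pose a i := (ab i).1; pose b i := (ab i).2.
  have mS : measurable S.
    rewrite SE; apply: bigcap_measurable => // i _.
    exact: measurable_noise_preimage.
  have SP x : \1_S x = \prod_(i <- J) \1_(Z i @^-1` B i) x :> R.
    rewrite prod_indic SE; congr (\1_ _ x); apply/seteqP; split=> y yB i.
      by move=> _; exact: yB.
    move=> _; have [iJ|iJ] := boolP (i \in J); first exact: yB.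
    by rewrite /preimage/= JB.
  have bS : ae_bounded P (\1_S).
    split; first exact: measurable_indic.
    by exists 1; apply: nearW => x; rewrite indicE normr_nat; case: (_ \in _).
  have fSi : P.-integrable setT (EFin \o (fun x => f x * \1_S x)).
    exact: integrable_mul_ae_bounded.
  rewrite integral_mkcond.
  rewrite (_ : _ \_ S = EFin \o (fun x => f x * \1_S x)); last first.
    apply/funext => x; rewrite patchE /= indicE.
    by case: (x \in S); rewrite ?mulr1 ?mulr0.
  rewrite -[LHS]fineK ?integrable_fin_num//; congr EFin.
  (* The vanishing of these integrals is the product formula with [k = 0], for which any [m] would
     do. *)
  have hX (s : {fset nat}) : \int[P]_x (f x * \prod_(i <- s) Z i x) =
      0 * \prod_(i <- s) (0 : R) by rewrite mul0r; exact: f0.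
  have := affine_prod_integral a b (J := fset0) fi ae_bounded_noise hX
    (fset_uniq J) _.
  rewrite !mul0r => <-//.
  apply: ae_eq_Rintegral => //.
    apply: integrable_mul_ae_bounded fi _; apply: ae_boundedM.
      by apply: ae_bounded_prod; exact: ae_bounded_noise.
    by apply: ae_bounded_prod => i; exact/ae_bounded_affine/ae_bounded_noise.
  apply: filterS noise_ae_all => x Zx.
  rewrite SP big_seq_fset0 mul1r; congr (_ * _); apply: eq_bigr => i _.
  by rewrite /a /b -abE.
have all0 S : measurable S -> (\int[P]_(x in S) (f x)%:E = 0)%E.
  rewrite measurable_cylinder.
  have T0 : (\int[P]_x (f x)%:E = 0)%E.
    apply: cyl0; exists fset0, (fun=> setT); split => //.
    by apply/seteqP; split.
  apply: (dynkin_induction (P := fun S => \int[P]_(x in S) (f x)%:E = 0)%E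
    measurable_cylinder cylinder_setI) => //.
  - move=> S' mS' S'0; have := T0; rewrite -(setUv S') integral_setU//.
    + by rewrite S'0 add0e.
    + exact: measurableC.
    + by rewrite setUv; exact: measurable_int fi.
    + by rewrite disj_set2E setICr.
  - move=> F mF tF F0; rewrite integral_bigcup//.
      by apply: eseries0 => n _ _; exact: F0.
    apply: integrableS fi => //; exact: bigcup_measurable.
have h : ae_eq P setT (EFin \o f) (cst 0%E).
  apply: integral_ae_eq => // E _ mE.
  by rewrite integral0; exact: all0.
by apply: filterS h => x /(_ I) [].
Qed.

Lemma canonical_vecE (s : {fset nat}) :
  canonical_vec Z s =
  (\pi_(cL2 P) (CLfunSub (noise_prod_cLfun2 s bZ)))%qT.
Proof.
rewrite /canonical_vec /cL2_class; congr (\pi_(cL2 P) _)%qT.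
by apply/val_inj; rewrite insubdK //; exact: noise_prod_cLfun2 bZ.
Qed.

Lemma canonical_vec_orthonormal (s t : {fset nat}) :
  cL2_ip (canonical_vec Z s) (canonical_vec Z t) = (s == t)%:R.
Proof.
rewrite !canonical_vecE cL2_ipE /=.
apply/eqP; rewrite eq_complex; apply/andP; split; apply/eqP => /=.
  transitivity ((s == t)%:R : R); last by case: (s == t).
  rewrite -noise_prod_orthonormal; apply: eq_Rintegral => x _.
  by rewrite oppr0 mul0r subr0.
transitivity (0 : R); last by case: (s == t).
transitivity (\int[P]_x (cst 0 x : R)); last by rewrite Rintegral_cst// mul0r.
by apply: eq_Rintegral => x _; rewrite oppr0 mul0r mulr0 addr0.
Qed.

(** The noise products are real, so orthogonality splits into one condition on the real part of [v]
    and one on the imaginary part. Both parts are integrable, because [L^2] lies in [L^1] under a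
    probability. *)
Lemma canonical_vec_total (v : cL2 P) :
  (forall s, cL2_ip (canonical_vec Z s) v = 0) -> v = 0.
Proof.
move: v; apply: cL2W => f hf; have /andP[rf mf] := CLfunP f.
have L1 (g : T -> R) : g \in Lfun P 2%:E -> P.-integrable setT (EFin \o g).
  move=> gL; apply/Lfun1_integrable.
  exact: (Lfun_subset12 (fin_num_measure P _ measurableT)) gL.
have ip0 s : \int[P]_x (Re (f x) * noise_prod Z s x) = 0 /\
    \int[P]_x (Im (f x) * noise_prod Z s x) = 0.
  have := hf s; rewrite canonical_vecE cL2_ipE => -[r i]; split.
    rewrite -[RHS]r; apply: eq_Rintegral => x _.
    by rewrite Re_cmulJ /= mul0r addr0 mulrC.
  rewrite -[RHS]i; apply: eq_Rintegral => x _.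
  by rewrite Im_cmulJ /= mul0r subr0 mulrC.
have re0 := noise_prod_separates _ (L1 _ rf) (fun s => (ip0 s).1).
have im0 := noise_prod_separates _ (L1 _ mf) (fun s => (ip0 s).2).
apply/cL2_pieqP; apply: filterS2 re0 im0 => x /= r i.
by apply/eqP; rewrite eq_complex r i !eqxx.
Qed.

End noise.

(** * Sums of nonnegative families, and truncations of the weighted count *)

Lemma esum_lty_fset {R : realType} {I : choiceType} (f : I -> R) :
  (forall i, 0 <= f i) ->
  (\esum_(i in [set: I]) (f i)%:E < +oo)%E <->
  exists M, forall A : {fset I}, \sum_(i <- A) f i <= M.
Proof.
move=> f0; split=> [foo|[M fM]].
  exists (fine (\esum_(i in [set: I]) (f i)%:E)) => A.
  rewrite -lee_fin fineK; last first.
    by rewrite ge0_fin_numE// esum_ge0// => i _; rewrite lee_fin.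
  apply: esum_ge; exists [set` A]; first by split => //; exact: finite_fset.
  by rewrite fsbig_finite//= set_fsetK sumEFin.
apply: (@le_lt_trans _ _ M%:E); last exact: ltry.
apply: ge_ereal_sup => _ [A [finA _] <-].
by rewrite fsbig_finite//= sumEFin lee_fin.
Qed.

Section weighted_count.
Context {R : realType} (u : nat -> R).
Implicit Types s : {fset nat}.

Definition partial_count (n : nat) s : R := \sum_(0 <= k < n) (k \in s)%:R * u k.

Lemma weighted_countE s : exists N, forall n, (N <= n)%N ->
  partial_count n s = weighted_count u s.
Proof.
(* The successor makes [N] exceed every element of [s], so the terms from [N] on vanish. *)
pose N := (\max_(k <- s) k.+1)%N.
have NE n : (N <= n)%N -> partial_count n s = partial_count N s.
  move=> Nn; rewrite /partial_count (big_cat_nat (leq0n N) Nn)//=.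
  rewrite [X in _ + X]big_nat_cond [X in _ + X]big1 ?addr0//.
  move=> k; rewrite andbT => /andP[Nk _].
  have [ks|] := boolP (k \in s); last by rewrite mul0r.
  have := @leq_bigmax_seq _ (enum_fset s) xpredT (fun k => k.+1) k ks isT.
  by rewrite leqNgt ltnS Nk.
exists N => n Nn; rewrite NE//; apply/esym/cvg_lim => //.
by apply: cvg_near_cst; exists N => // m; exact: NE.
Qed.

Lemma weighted_count_fset (A : {fset {fset nat}}) : exists N, forall n,
  (N <= n)%N -> {in A, forall s, partial_count n s = weighted_count u s}.
Proof.
have [N hN] := choice weighted_countE.
exists (\max_(s <- A) N s)%N => n Nn s sA; apply: hN; apply: leq_trans Nn.
exact: (@leq_bigmax_seq _ (enum_fset A) xpredT N).
Qed.

Hypothesis u0 : forall k, 0 <= u k.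

Lemma partial_count_ge0 n s : 0 <= partial_count n s.
Proof. by apply: sumr_ge0 => k _; rewrite mulr_ge0. Qed.

Lemma partial_count_le n s : partial_count n s <= weighted_count u s.
Proof.
have [N hN] := weighted_countE s; rewrite -(hN (maxn n N)) ?leq_maxr//.
rewrite /partial_count (big_cat_nat (leq0n n) (leq_maxl n N))//= lerDl.
by apply: sumr_ge0 => k _; rewrite mulr_ge0.
Qed.

End weighted_count.

(** * The number operator in the canonical basis *)

Section number_operator.
Context {R : realType} {d : measure_display} {T : measurableType d}.
Context {P : probability T R} {p : nat -> R} {Z : nat -> {RV P >-> R}}.
Context {D Dstar : nat -> cL2 P -> cL2 P} {u : nat -> R}.
Hypothesis bZ : bernoulli_noise p Z.
Hypothesis annD : forall k, annihilation Z k (D k).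
Hypothesis adjD : forall k, is_adjoint (D k) (Dstar k).

Let e_on := canonical_vec_orthonormal bZ.
Let e_total := canonical_vec_total bZ.

Lemma ip_adjointr k v w : cL2_ip v (Dstar k w) = cL2_ip (D k v) w.
Proof. by rewrite cL2_ipC adjD -cL2_ipC. Qed.

(** By totality it is enough to compare the coefficients against each canonical vector of index [t],
    where the adjoint relation brings back the known action of [D k]. *)
Lemma adjoint_canonical_vec k (s : {fset nat}) : k \in s ->
  Dstar k (canonical_vec Z (s `\ k)%fset) = canonical_vec Z s.
Proof.
move=> ks; apply/eqP; rewrite -subr_eq0; apply/eqP/e_total => t.
rewrite cL2_ipBr ip_adjointr (annD k).2 e_on.
have [kt|kt] := boolP (k \in t).
  (* Removing [k] is injective on the sets that contain it. *)
  rewrite e_on (_ : _ == _ = (t == s)) ?subrr//.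
  apply/eqP/eqP => [ts|->//]; rewrite -(fsetD1K ks) -(fsetD1K kt).
  by rewrite ts.
rewrite cL2_ip0l sub0r (_ : _ == _ = false) ?oppr0//.
by apply: contraNF kt => /eqP ->.
Qed.

(** Moving [Dstar k] to the left removes [k] from [s]; moving the remaining [D k] to the left, as
    its adjoint, puts [k] back. *)
Lemma ip_number_term k (s : {fset nat}) xi :
  cL2_ip (canonical_vec Z s) (Dstar k (D k xi)) =
  (k \in s)%:R * cL2_ip (canonical_vec Z s) xi.
Proof.
rewrite ip_adjointr (annD k).2; have [ks|ks] := boolP (k \in s).
  by rewrite -adjD adjoint_canonical_vec// mul1r.
by rewrite cL2_ip0l mul0r.
Qed.

Lemma ip_number_series n (s : {fset nat}) xi :
  cL2_ip (canonical_vec Z s) (number_series D Dstar u xi n) =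
  (partial_count u n s)%:C * cL2_ip (canonical_vec Z s) xi.
Proof.
rewrite cL2_ip_sumr /partial_count rmorph_sum mulr_suml; apply: eq_bigr => k _.
by rewrite cL2_ipZr ip_number_term rmorphM/= rmorph_nat mulrCA mulrA.
Qed.

Lemma normc_realM (r : R) (z : R[i]) :
  normc (r%:C * z) ^+ 2 = r ^+ 2 * normc z ^+ 2.
Proof. by rewrite !normc2E Defs.ReM Defs.ImM /=; ring. Qed.

Let coef xi s : R[i] :=
  (weighted_count u s)%:C * cL2_ip (canonical_vec Z s) xi.

Lemma ip_number_limit xi eta s :
  number_series D Dstar u xi @ \oo --> eta ->
  cL2_ip (canonical_vec Z s) eta = coef xi s.
Proof.
move=> /(ip_limit _ e_on); apply.
have [N hN] := weighted_countE u s.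
by exists N => // n Nn; rewrite ip_number_series hN.
Qed.

Hypothesis u0 : forall k, 0 <= u k.

(** The set [A] is chosen first, from the Fourier expansion of [eta], and the threshold [N] then
    depends on [A]. Nonnegativity of [u] keeps each truncated count between 0 and the full count,
    which gives the domination off [A]. *)
Lemma cvg_number_series xi eta :
  (forall s, cL2_ip (canonical_vec Z s) eta = coef xi s) ->
  number_series D Dstar u xi @ \oo --> eta.
Proof.
move=> etaE; apply/cL2_cvgP => eps eps0.
have /cL2_cvgP /(_ _ eps0) /filter_ex [A etaA] :=
  fourier_expansion _ e_on e_total eta.
have [N hN] := weighted_count_fset u A.
exists N => // n Nn; apply: le_trans etaA.
apply: (cL2_norm_le _ e_on e_total) => s.
rewrite !cL2_ipBr ip_lincomb// ip_number_series etaE /coef.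
have [sA|sA] := boolP (s \in A).
  by rewrite hN// subrr normc0 normc_nneg.
(* Off [A], the full count minus its truncation is compared with the full count, both as factors of
   the same coefficient of [xi]. *)
rewrite mul0r subr0 -mulrBl -raddfB.
rewrite -(@ler_pXn2r _ 2) ?nnegrE ?normc_nneg// !normc_realM.
apply: ler_wpM2r; first exact: sqr_ge0.
have w0 := partial_count_ge0 u u0 n s; have wu := partial_count_le u u0 n s.
rewrite lerXn2r ?nnegrE ?subr_ge0 ?gerBl//.
exact: le_trans wu.
Qed.

Lemma esum_coef_lty xi :
  (\esum_(s in [set: {fset nat}])
    (weighted_count u s ^+ 2 *
     normc (cL2_ip (canonical_vec Z s) xi) ^+ 2)%:E < +oo)%E <->
  exists M, forall A : {fset {fset nat}},
    \sum_(s <- A) normc (coef xi s) ^+ 2 <= M.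
Proof.
rewrite esum_lty_fset; last by move=> s; rewrite mulr_ge0 ?sqr_ge0.
by split=> -[M hM]; exists M => A; rewrite (le_trans _ (hM A))//;
  apply: ler_sum => s _; rewrite /coef normc_realM.
Qed.

End number_operator.

Theorem theorem4p5 (R : realType) (d : measure_display) (T : measurableType d)
    (P : probability T R) (p : nat -> R) (Z : nat -> {RV P >-> R})
    (D Dstar : nat -> {linear cL2 P -> cL2 P}) (u : nat -> R) :
  bernoulli_noise p Z ->
  (forall k, annihilation Z k (D k)) ->
  (forall k, is_adjoint (D k) (Dstar k)) ->
  (forall k, 0 <= u k) ->
  (exists M : R, forall k, u k <= M) ->
  forall xi : cL2 P,
    (number_dom D Dstar u xi <->
      (\esum_(s in [set: {fset nat}])
         (weighted_count u s ^+ 2 *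
          normc (cL2_ip (canonical_vec Z s) xi) ^+ 2)%:E < +oo)%E) /\
    (number_dom D Dstar u xi ->
      summability.partial_sum (fun s : {fset nat} =>
          ((weighted_count u s)%:C * cL2_ip (canonical_vec Z s) xi)
            *: canonical_vec Z s) @ summability.totally
        --> number_op D Dstar u xi).
Proof.
move=> bZ annD adjD u0 _ xi.
have e_on := canonical_vec_orthonormal bZ.
have e_total := canonical_vec_total bZ.
split; [split|].
(* Membership in the domain is by definition convergence to [number_op], so the coefficients of that
   vector are known and Bessel applies to them. *)
- move=> /(ip_number_limit bZ annD adjD) cE; apply/esum_coef_lty.
  exists (cL2_norm (number_op D Dstar u xi) ^+ 2) => A.
  have := bessel _ e_on (number_op D Dstar u xi) A.
  by under eq_bigr do rewrite cE.
- move=> /esum_coef_lty[M cM].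
  have [eta heta] := riesz_fischer _ e_on cM.
  apply: cvgP; apply: (cvg_number_series bZ annD adjD u0 xi eta) => s.
  (* The partial sums have the prescribed coefficient at [s] as soon as the finite set contains
     [s]. *)
  apply: (ip_limit _ e_on heta); exists [fset s]%fset => //= A.
  by rewrite /= fsub1set ip_lincomb// => ->; rewrite mul1r.
- move=> /(ip_number_limit bZ annD adjD) cE.
  (* The series in the statement is the Fourier expansion of [number_op] applied to [xi]. *)
  rewrite (_ : summability.partial_sum _ = lincomb (canonical_vec Z)
      (fun s => cL2_ip (canonical_vec Z s) (number_op D Dstar u xi))).
    exact: fourier_expansion.
  apply/funext => A.
  rewrite /lincomb /summability.partial_sum big_seq_fsetE.
  by apply: eq_bigr => s _; rewrite cE.
Qed.
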